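(* Let $q \in (1,2)$ be a regular Pisot number and $q'$ a Galois conjugate of $q$. Then $|q'| \geq \frac{\sqrt5-1}{2}$.
   Context: A Pisot number is a real algebraic integer $q>1$ all of whose other Galois conjugates have absolute value strictly less than $1$. For integers $r \geq 1$ let $\Phi_r(x) = x^{r+1}-2x^r+x-1$, $\Psi_r(x) = x^{r+1}-x^r-\cdots-x-1$, and let $X(x) = x^4-x^3-2x^2+1$. Let $\phi_r$, $\psi_r$, $\chi$ be the roots in $(1,2)$ of $\Phi_r$, $\Psi_r$, $X$ respectively (these are the limit points of the Pisot numbers in $(1,2)$). For integers $r \geq 1$, $n \geq 1$ define $\Phi_{A,r,n}^{\pm}(x) = \Phi_r(x)x^n \pm (x^r-x^{r-1}+1)$, $\Phi_{B,r,n}^{\pm}(x) = \Phi_r(x)x^n \pm (x^r-x+1)$, $\Phi_{C,r,n}^{\pm}(x) = \Phi_r(x)x^n \pm (x^r+1)(x-1)$, $\Psi_{A,r,n}^{\pm}(x) = \Psi_r(x)x^n \pm (x^{r+1}-1)$, $\Psi_{B,r,n}^{\pm}(x) = \Psi_r(x)x^n \pm (x^r-1)/(x-1)$, $X_{A,n}^{\pm}(x) = X(x)x^n \pm (x^3+x^2-x-1)$, $X_{B,n}^{\pm}(x) = X(x)x^n \pm (x^4-x^2+1)$. A regular Pisot number in $(1,2)$ is either one of the numbers $\phi_r, \psi_r$ ($r\ge1$), $\chi$, or a Pisot number in $(1,2)$ which is a root of one of the polynomials $\Phi_{A,r,n}^{\pm},\Phi_{B,r,n}^{\pm},\Phi_{C,r,n}^{\pm},\Psi_{A,r,n}^{\pm},\Psi_{B,r,n}^{\pm},X_{A,n}^{\pm},X_{B,n}^{\pm}$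 (for some $r \ge 1$, $n\ge 1$). *)

(* Defs.v *)
From HB Require Import structures.
From mathcomp Require Import all_boot all_order all_algebra all_field.
Set Implicit Arguments. Unset Strict Implicit. Unset Printing Implicit Defensive.
Import Order.TTheory GRing.Theory Num.Theory.
Local Open Scope ring_scope.

Definition galois_conj (q q' : algC) : Prop := root (minCpoly q) q'.

Definition pisot (q : algC) : Prop :=
  [/\ q \is Num.real, q \in Aint, 1 < q &
      forall q', galois_conj q q' -> q' != q -> `|q'| < 1].

Definition Phi (r : nat) (x : algC) := x ^+ r.+1 - 2 * x ^+ r + x - 1.
Definition Psi (r : nat) (x : algC) := x ^+ r.+1 - \sum_(i < r.+1) x ^+ i.
Definition Xpol (x : algC) := x ^+ 4 - x ^+ 3 - 2 * x ^+ 2 + 1.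

Definition sgn (s : bool) : algC := if s then 1 else -1.

Definition PhiA s r n x := Phi r x * x ^+ n + sgn s * (x ^+ r - x ^+ r.-1 + 1).
Definition PhiB s r n x := Phi r x * x ^+ n + sgn s * (x ^+ r - x + 1).
Definition PhiC s r n x := Phi r x * x ^+ n + sgn s * ((x ^+ r + 1) * (x - 1)).
Definition PsiA s r n x := Psi r x * x ^+ n + sgn s * (x ^+ r.+1 - 1).
(* (x^r - 1)/(x - 1) = 1 + x + ... + x^(r-1) as a polynomial *)
Definition PsiB s r n x := Psi r x * x ^+ n + sgn s * (\sum_(i < r) x ^+ i).
Definition XA s n x := Xpol x * x ^+ n + sgn s * (x ^+ 3 + x ^+ 2 - x - 1).
Definition XB s n x := Xpol x * x ^+ n + sgn s * (x ^+ 4 - x ^+ 2 + 1).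

Definition regular_pisot (q : algC) : Prop :=
  pisot q /\ 1 < q < 2 /\
  ( (exists r, (1 <= r)%N /\ (Phi r q = 0 \/ Psi r q = 0))
  \/ Xpol q = 0
  \/ (exists s r n, (1 <= r)%N /\ (1 <= n)%N /\
        [\/ (PhiA s r n q = 0 \/ PhiB s r n q = 0), PhiC s r n q = 0,
            PsiA s r n q = 0 | PsiB s r n q = 0])
  \/ (exists s n, (1 <= n)%N /\ (XA s n q = 0 \/ XB s n q = 0))).

(* Main.v *)
Require Import Defs.
From mathcomp Require Import all_boot all_order all_algebra all_field.
From mathcomp Require Import ring lra.
Set Implicit Arguments. Unset Strict Implicit. Unset Printing Implicit Defensive.
Import Order.TTheory GRing.Theory Num.Theory.
Local Open Scope ring_scope.

(* A conjugate q' satisfies every equation with rational coefficients that q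
   satisfies. Suppose t = |q'| is below the golden bound, i.e. t^2 + t < 1.
   In each family the defining polynomial can be rewritten as B = e (B + R),
   where e is a power of q' (up to sign) and R is a small explicit remainder,
   possibly after multiplication by q' - 1 or q' + 1; the triangle inequality
   and t^2 + t < 1 then rule out a zero. This uses |e| <= t^2 and so covers the
   exponents n >= 2; for n = 1 either a similar estimate applies after
   cancelling a factor, or the polynomial has no root in (1, 2). *)

(** * Rational polynomial functions and Galois conjugates *)

Definition ratpolyfun (F : algC -> algC) :=
  exists p : {poly rat}, forall x, F x = (map_poly ratr p).[x].

Lemma ratpolyfun_id : ratpolyfun id.
Proof. by exists 'X => x; rewrite map_polyX hornerX. Qed.

Lemma ratpolyfunD F G : ratpolyfun F -> ratpolyfun G -> ratpolyfun (fun x => F x + G x).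
Proof. by case=> p Fp [q Gq]; exists (p + q) => x; rewrite Fp Gq rmorphD hornerD. Qed.

Lemma ratpolyfunM F G : ratpolyfun F -> ratpolyfun G -> ratpolyfun (fun x => F x * G x).
Proof. by case=> p Fp [q Gq]; exists (p * q) => x; rewrite Fp Gq rmorphM hornerM. Qed.

Lemma ratpolyfun_nat n : ratpolyfun (fun=> n%:R).
Proof. by exists n%:R => x; rewrite rmorph_nat -polyC_natr hornerC. Qed.

Lemma ratpolyfunN F : ratpolyfun F -> ratpolyfun (fun x => - F x).
Proof. by case=> p Fp; exists (- p) => x; rewrite Fp rmorphN hornerN. Qed.

Lemma ratpolyfunX F n : ratpolyfun F -> ratpolyfun (fun x => F x ^+ n).
Proof. by case=> p Fp; exists (p ^+ n) => x; rewrite Fp rmorphXn horner_exp. Qed.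

Lemma ratpolyfun_sumX n : ratpolyfun (fun x => \sum_(i < n) x ^+ i).
Proof.
exists (\sum_(i < n) 'X ^+ i) => x; rewrite rmorph_sum horner_sum.
by apply: eq_bigr => i _; rewrite rmorphXn /= map_polyX hornerXn.
Qed.

Lemma ratpolyfun_sgn s : ratpolyfun (fun=> sgn s).
Proof. by case: s; [exact: (ratpolyfun_nat 1) | exact: ratpolyfunN (ratpolyfun_nat 1)]. Qed.

Ltac ratpoly := repeat first
  [ exact: ratpolyfun_id | exact: ratpolyfun_sumX | exact: ratpolyfun_sgn
  | exact: (ratpolyfun_nat 1) | exact: ratpolyfun_nat
  | apply: (@ratpolyfunD (fun x => _) (fun x => _)) | apply: (@ratpolyfunN (fun x => _))
  | apply: (@ratpolyfunX (fun x => _)) | apply: (@ratpolyfunM (fun x => _) (fun x => _)) ].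

Lemma ratpolyfun_Phi r : ratpolyfun (Phi r).
Proof. rewrite /Phi; ratpoly. Qed.

Lemma ratpolyfun_Psi r : ratpolyfun (Psi r).
Proof. rewrite /Psi; ratpoly. Qed.

Lemma ratpolyfun_Xpol : ratpolyfun Xpol.
Proof. rewrite /Xpol; ratpoly. Qed.

Lemma ratpolyfun_PhiA s r n : ratpolyfun (PhiA s r n).
Proof. rewrite /PhiA /Phi; ratpoly. Qed.

Lemma ratpolyfun_PhiB s r n : ratpolyfun (PhiB s r n).
Proof. rewrite /PhiB /Phi; ratpoly. Qed.

Lemma ratpolyfun_PhiC s r n : ratpolyfun (PhiC s r n).
Proof. rewrite /PhiC /Phi; ratpoly. Qed.

Lemma ratpolyfun_PsiA s r n : ratpolyfun (PsiA s r n).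
Proof. rewrite /PsiA /Psi; ratpoly. Qed.

Lemma ratpolyfun_PsiB s r n : ratpolyfun (PsiB s r n).
Proof. rewrite /PsiB /Psi; ratpoly. Qed.

Lemma ratpolyfun_XA s n : ratpolyfun (XA s n).
Proof. rewrite /XA /Xpol; ratpoly. Qed.

Lemma ratpolyfun_XB s n : ratpolyfun (XB s n).
Proof. rewrite /XB /Xpol; ratpoly. Qed.

(** The minimal polynomial of [q] over the rationals divides the polynomial behind [F], so all its
    roots are zeros of [F]. *)
Lemma galois_conj_root F q q' : ratpolyfun F -> galois_conj q q' -> F q = 0 -> F q' = 0.
Proof.
case=> p Fp qq'; rewrite !Fp => /rootP; have [m [Dm _] min_q] := minCpolyP q.
rewrite min_q => /dvdpP[s ->]; move: qq'.
by rewrite /galois_conj Dm rmorphM hornerM => /rootP->; rewrite mulr0.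
Qed.

(** * The modulus and its triangle inequalities *)

(* The modulus, with values in a totally ordered field where lra and nra apply. *)
Definition nrm (z : algC) : algR := in_algR (normr_real z).

Lemma nrm_ge0 z : 0 <= nrm z.
Proof. exact: normr_ge0. Qed.

Lemma ler_nrmD z w : nrm (z + w) <= nrm z + nrm w.
Proof. exact: ler_normD. Qed.

Lemma nrmN z : nrm (- z) = nrm z.
Proof. by apply: val_inj; apply: normrN. Qed.

Lemma nrm1 : nrm 1 = 1.
Proof. by apply: val_inj; apply: normr1. Qed.

Lemma nrmM z w : nrm (z * w) = nrm z * nrm w.
Proof. by apply: val_inj; apply: normrM. Qed.

Lemma nrmX z n : nrm (z ^+ n) = nrm z ^+ n.
Proof. by elim: n => [|n IHn]; rewrite ?expr0 ?nrm1 // !exprS nrmM IHn. Qed.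

Lemma nrm0 : nrm 0 = 0.
Proof. by apply: val_inj; apply: normr0. Qed.

Lemma ler_nrmB_nrmD z w : nrm z - nrm w <= nrm (z + w).
Proof. by have := ler_nrmD (z + w) (- w); rewrite nrmN addrK; lra. Qed.

Lemma nrm_sub1 z : 1 - nrm z <= nrm (z - 1) <= 1 + nrm z.
Proof.
have := ler_nrmB_nrmD (- 1) z; have := ler_nrmD z (- 1).
by rewrite (addrC (-1)) nrmN nrm1 (addrC (nrm z)) => -> ->.
Qed.

(** The triangle inequality applied to a = e (a + b): a small e forces a to be small against b. Each
    use plays this off against a lower bound for |a|. *)
Lemma nrm_perturb e a b : a = e * (a + b) -> (1 - nrm e) * nrm a <= nrm e * nrm b.
Proof.
move=> /(congr1 nrm); rewrite nrmM => Da.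
by have := ler_wpM2l (nrm_ge0 e) (ler_nrmD a b); rewrite -Da; lra.
Qed.

Lemma small_bounds z t : nrm z = t -> t ^+ 2 + t < 1 -> 0 <= t < 1.
Proof. move=> <- ht; rewrite nrm_ge0 /=; have := nrm_ge0 z; nra. Qed.

(** * Non-vanishing below the golden bound *)

(* Below, p stands for z^n up to sign (n >= 2), u for z^r, v for z^(r-1), w for
   z^(r+1) and S for 1 + z + ... + z^r; only bounds on their moduli matter. *)
Lemma golden_nz z t : nrm z = t -> t ^+ 2 + t < 1 ->
  z ^+ 2 - z - 1 != 0.
Proof.
move=> tE ht; have /andP[t0 t1] := small_bounds tE ht.
apply/eqP => H; have /(congr1 nrm) : z ^+ 2 + - z = 1 by rewrite -[RHS]addr0 -H; ring.
clear H.
have := ler_nrmD (z ^+ 2) (- z); rewrite nrmN nrmX nrm1 ?tE => h E; lra.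
Qed.

(** With w = z^(r+1) this is (z - 1) Psi_r(z). A zero gives w (2 - z) = 1, while t^2 (2 + t) <= t^2
    + t < 1. *)
Lemma psi_nz z t w : nrm z = t -> t ^+ 2 + t < 1 -> nrm w <= t ^+ 2 ->
  w * z - 2 * w + 1 != 0.
Proof.
move=> tE ht; have /andP[t0 t1] := small_bounds tE ht.
move=> hw; apply/eqP => H; have /(congr1 nrm) : w * (2 - z) = 1 by rewrite -[RHS]subr0 -H; ring.
clear H.
have := ler_nrmD 1 (1 - z); have := ler_nrmD 1 (- z); rewrite nrmM nrmN nrm1 ?tE => h1.
have -> : 1 + (1 - z) = 2 - z by ring.
have := nrm_ge0 w. nra.
Qed.

(** The factor 1 + z removes the linear term and the coefficient 2: a zero gives z^4 - z^3 - z^2 =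
    1, but t^4 + t^3 + t^2 <= 2 t^2 < 1. *)
Lemma phi2_nz z t : nrm z = t -> t ^+ 2 + t < 1 ->
  z ^+ 3 - 2 * z ^+ 2 + z - 1 != 0.
Proof.
move=> tE ht; have /andP[t0 t1] := small_bounds tE ht.
apply/eqP => H; have /(congr1 nrm) : z ^+ 4 + - z ^+ 3 + - z ^+ 2 = 1.
  by rewrite -[RHS]addr0 -(mulr0 (1 + z)) -H; ring.
clear H.
have := ler_nrmD (z ^+ 4 + - z ^+ 3) (- z ^+ 2); have := ler_nrmD (z ^+ 4) (- z ^+ 3).
rewrite !nrmN !nrmX nrm1 ?tE. nra.
Qed.

(** The case r >= 3. It rests on t^3 < (1 - t^3) (1 - t), which can fail with t^2 in place of t^3;
    hence the separate lemma for r = 2. *)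
Lemma phi_nz z t u : nrm z = t -> t ^+ 2 + t < 1 -> nrm u <= t ^+ 3 ->
  u * (z - 2) + z - 1 != 0.
Proof.
move=> tE ht; have /andP[t0 t1] := small_bounds tE ht.
move=> hu; apply/eqP => H.
have /nrm_perturb : z - 1 = - u * ((z - 1) + - 1).
  by apply/eqP; rewrite -subr_eq0 -H; apply/eqP; ring.
clear H.
have /andP[+ _] := nrm_sub1 z; rewrite !nrmN nrm1 ?tE => hy.
have := nrm_ge0 u.
have : t ^+ 3 < (1 - t ^+ 3) * (1 - t) by nra.
have : t ^+ 3 <= 1 by nra.
move=> h1 h2 h3 h4.
suff : (1 - t ^+ 3) * (1 - t) <= (1 - nrm u) * nrm (z - 1) by lra.
apply: ler_pM; lra.
Qed.

(** X(z) = (z^2 - 1)^2 - z^3, and |z^2 - 1| >= 1 - t^2 > t makes the square too large. *)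
Lemma xpol_nz z t : nrm z = t -> t ^+ 2 + t < 1 ->
  z ^+ 4 - z ^+ 3 - 2 * z ^+ 2 + 1 != 0.
Proof.
move=> tE ht; have /andP[t0 t1] := small_bounds tE ht.
apply/eqP => H; have /(congr1 nrm) : (z ^+ 2 - 1) ^+ 2 = z ^+ 3.
  by apply/eqP; rewrite -subr_eq0 -H; apply/eqP; ring.
clear H.
have /andP[] := nrm_sub1 (z ^+ 2); rewrite !nrmX ?tE; set m := nrm _ => h1 _ E.
have h2 : t <= m by lra.
have : t * t <= m * m by apply: ler_pM.
have : t * t < (1 - t^+2) * (1 - t ^+ 2) by nra.
have : (1 - t^+2) * (1 - t ^+ 2) <= m * m by apply: ler_pM => //; nra.
nra.
Qed.

(** The polynomial of the plastic number: with the plus sign it is [PhiC] for r = n = 1 and a factor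
    of [XB] for n = 1. *)
Lemma plastic_nz z t : nrm z = t -> t ^+ 2 + t < 1 ->
  z ^+ 3 - z - 1 != 0.
Proof.
move=> tE ht; have /andP[t0 t1] := small_bounds tE ht.
apply/eqP => H; have /(congr1 nrm) : z ^+ 3 + - z = 1 by rewrite -[RHS]addr0 -H; ring.
clear H.
have := ler_nrmD (z ^+ 3) (- z); rewrite nrmN nrmX nrm1 ?tE. nra.
Qed.

Lemma tribonacci_nz z t : nrm z = t -> t ^+ 2 + t < 1 ->
  z ^+ 3 - z ^+ 2 - z - 1 != 0.
Proof.
move=> tE ht; have /andP[t0 t1] := small_bounds tE ht.
apply: contra_neq (@psi_nz z t (z ^+ 3) tE ht _) => [H|]; last by rewrite nrmX ?tE; nra.
by rewrite -(mulr0 (z - 1)) -H; ring.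
Qed.

(** A form to which several families reduce. A zero gives p (1 + z - z^2) = 1, but t^2 (1 + t + t^2)
    <= 2 t^2 < 1. *)
Lemma golden_perturb_nz z t p : nrm z = t -> t ^+ 2 + t < 1 -> nrm p <= t ^+ 2 ->
  (z ^+ 2 - z - 1) * p + 1 != 0.
Proof.
move=> tE ht; have /andP[t0 t1] := small_bounds tE ht.
move=> hp; apply/eqP => H; have /(congr1 nrm) : p * (1 + (z + - z ^+ 2)) = 1.
  by rewrite -[RHS]subr0 -H; ring.
clear H.
have := ler_nrmD 1 (z + - z ^+ 2); have := ler_nrmD z (- z ^+ 2).
rewrite nrmM nrm1 nrmN nrmX ?tE; have := nrm_ge0 p; nra.
Qed.

(** This stands for (z - 1) [PsiB]. Solving for 1 leaves terms of total size at most 2 t^2 + t^3,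
    because t^5 (2 + t) <= t^3; that is below 1 as in [psi_nz]. *)
Lemma psiB_nz z t u p : nrm z = t -> t ^+ 2 + t < 1 -> nrm u <= t ^+ 2 -> nrm p <= t ^+ 2 ->
  (u * z ^+ 2 - 2 * u * z + 1) * p + (u - 1) != 0.
Proof.
move=> tE ht; have /andP[t0 t1] := small_bounds tE ht.
move=> hu hp; apply/eqP => H; have /(congr1 nrm) : p + u + u * p * (z * ((z - 1) - 1)) = 1.
  by rewrite -[RHS]addr0 -H; ring.
clear H.
have := ler_nrmD (p + u) (u * p * (z * ((z - 1) - 1))); have := ler_nrmD p u.
have := ler_nrmD (z - 1) (-1); have /andP[_] := nrm_sub1 z.
rewrite !nrmM nrmN nrm1 ?tE; set m := nrm (_ - 1 - 1) => h1 h2 h3 h4 E.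
have m0 : 0 <= m by apply: nrm_ge0.
have : nrm u * nrm p * (t * m) <= t ^+ 2 * t ^+ 2 * (t * (2 + t)).
  apply: ler_pM; rewrite ?mulr_ge0 ?nrm_ge0 //.
    by apply: ler_pM; rewrite ?nrm_ge0.
  by apply: ler_pM; rewrite ?nrm_ge0 //; lra.
have h5 : t ^+ 2 * (2 + t) < 1 by nra.
have : t ^+ 3 * (t ^+ 2 * (2 + t)) <= t ^+ 3 by rewrite ler_piMr ?exprn_ge0 //; lra.
lra.
Qed.

Lemma psiA_nz z t S w p : nrm z = t -> t ^+ 2 + t < 1 ->
  nrm (S - 1) * (1 - t) <= t - nrm w -> nrm w < 1 -> nrm p <= t ^+ 2 ->
  (w - S) * p + (w - 1) != 0.
Proof.
move=> tE ht; have /andP[t0 t1] := small_bounds tE ht.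
move=> hS hw hp; apply/eqP => H.
have /nrm_perturb : w - 1 = - p * ((w - 1) + (1 - S)).
  by apply/eqP; rewrite -subr_eq0 -H; apply/eqP; ring.
clear H.
have /andP[+ _] := nrm_sub1 w; rewrite nrmN -(nrmN (1 - S)) opprB.
have := nrm_ge0 p; have := nrm_ge0 w; have := nrm_ge0 (S - 1).
set W := nrm w in hS hw *; set T := nrm (S - 1) in hS *.
set M := nrm (w - 1); set P := nrm p in hp *.
move=> T0 W0 P0 hM E.
have h1 : (1 - t ^+ 2) * (1 - W) <= t ^+ 2 * T.
  apply: (@le_trans _ _ ((1 - P) * M)); first by apply: ler_pM; nra.
  by apply: le_trans E _; apply: ler_wpM2r.
(* Since t - W <= t (1 - W), both sides carry the factor 1 - W. Cancelling it removes all dependence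
   on r. *)
have h2 : (1 - t ^+ 2) * (1 - W) * (1 - t) <= t ^+ 2 * (t * (1 - W)) by nra.
have : (1 - t ^+ 2) * (1 - t) <= t ^+ 3.
  by rewrite -(@ler_pM2r _ (1 - W)); lra.
have : t * t ^+ 2 < (1 - t ^+ 2) * (1 - t) by apply: ltr_pM; nra.
lra.
Qed.

(** With D = z^r - z^(r-1) + 1 one has Phi_r(z) = -((1 - z) D + v). The term (1 - z) D costs only
    the factor t^2 (1 + t) <= t, which leaves (1 - t)^2 <= t^4, against 1 - t > t^2. *)
Lemma phiA_nz z t v p : nrm z = t -> t ^+ 2 + t < 1 -> nrm v <= t ^+ 2 -> nrm p <= t ^+ 2 ->
  (v * z * (z - 2) + z - 1) * p + (1 - v * (1 - z)) != 0.
Proof.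
move=> tE ht; have /andP[t0 t1] := small_bounds tE ht.
move=> hv hp; apply/eqP => H.
set D := 1 - v * (1 - z) in H *; have DE : D = p * ((1 - z) * D + v).
  by apply/eqP; rewrite -subr_eq0 -H /D; apply/eqP; ring.
have := congr1 nrm DE; rewrite nrmM => E.
clear H DE.
have := ler_nrmD ((1 - z) * D) v; have := ler_nrmB_nrmD 1 (v * (z - 1)).
have -> : 1 + v * (z - 1) = D by rewrite /D; ring.
rewrite !nrmM nrm1 -(nrmN (1 - z)) opprB; have /andP[_] := nrm_sub1 z.
have := nrm_ge0 D; have := nrm_ge0 v; have := nrm_ge0 p; have := nrm_ge0 (z - 1); rewrite ?tE.
move: E hv hp; set d := nrm D; set V := nrm v; set P := nrm p; set y := nrm (z - 1).
set B := nrm (_ + v).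
move=> E hv hp y0 p0 v0 d0 hy hd hB.
have h1 : V * y <= t ^+ 2 * (1 + t) by apply: ler_pM.
have h0 : t ^+ 2 * (1 + t) <= t by nra.
have h2 : 1 - t <= d by lra.
have h3 : d <= t ^+ 2 * ((1 + t) * d + t ^+ 2).
  rewrite {1}E; apply: ler_pM => //; [exact: nrm_ge0 | nra].
have h4 : (1 - t) * (1 - t) <= d * (1 - t ^+ 2 * (1 + t)) by apply: ler_pM; nra.
have : t ^+ 2 * t ^+ 2 < (1 - t) * (1 - t) by apply: ltr_pM; nra.
lra.
Qed.

(** For r = 2 the families A and B coincide. *)
Lemma phi2AB_nz z t p : nrm z = t -> t ^+ 2 + t < 1 -> nrm p <= t ^+ 2 ->
  (z ^+ 3 - 2 * z ^+ 2 + z - 1) * p + (z ^+ 2 - z + 1) != 0.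
Proof.
move=> tE ht; have /andP[t0 t1] := small_bounds tE ht.
move=> hp; apply/eqP => H; set Q := z ^+ 2 - z + 1 in H *.
have /nrm_perturb : Q = p * (Q + z ^+ 2 * (1 - z)).
  by apply/eqP; rewrite -subr_eq0 -H /Q; apply/eqP; ring.
clear H.
(* The factor 1 + z yields |Q| >= (1 - t^3) / (1 + t); the direct bound 1 - t - t^2 would be nearly
   0 close to the golden bound. *)
have := congr1 nrm (_ : Q * (1 + z) = 1 + z ^+ 3); rewrite /Q => /(_ ltac:(ring)).
have := ler_nrmB_nrmD 1 (z ^+ 3); have := ler_nrmD 1 z; have /andP[_] := nrm_sub1 z.
rewrite !nrmX !nrmM ?nrmX nrm1 -(nrmN (1 - z)) opprB ?tE -/Q => h1 h2 h3 h4 h5.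
have := nrm_ge0 Q; have := nrm_ge0 p; have := nrm_ge0 (z - 1) => y0 p0 q0.
have h6 : nrm Q * (1 - t ^+ 2) <= t ^+ 2 * (t ^+ 2 * (1 + t)).
  apply: le_trans (_ : nrm p * (t ^+ 2 * nrm (z - 1)) <= _).
    apply: le_trans h5; rewrite mulrC; apply: ler_wpM2r => //; lra.
  by apply: ler_pM; rewrite ?mulr_ge0 ?exprn_ge0 //; apply: ler_wpM2l; rewrite ?exprn_ge0.
have h7 : 1 - t ^+ 3 <= nrm Q * (1 + t).
  by apply: le_trans (_ : _ <= nrm Q * nrm (1 + z)) _; [lra | apply: ler_wpM2l].
have h8 : (1 - t ^+ 3) * (1 - t ^+ 2) <= (t ^+ 2 * (1 + t)) ^+ 2.
  apply: le_trans (_ : nrm Q * (1 + t) * (1 - t ^+ 2) <= _); first by apply: ler_wpM2r => //; nra.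
  by nra.
have h9 : t ^+ 2 * (1 + t) <= t by nra.
have : (t ^+ 2 * (1 + t)) ^+ 2 <= t * t by apply: ler_pM => //; nra.
have : t * t < (1 - t ^+ 3) * (1 - t ^+ 2) by apply: ltr_pM => //; nra.
lra.
Qed.

Lemma phiB_nz z t u p : nrm z = t -> t ^+ 2 + t < 1 -> nrm u <= t ^+ 3 -> nrm p <= t ^+ 2 ->
  (u * (z - 2) + z - 1) * p + (u + (1 - z)) != 0.
Proof.
move=> tE ht; have /andP[t0 t1] := small_bounds tE ht.
move=> hu hp; apply/eqP => H.
have /nrm_perturb : u + (1 - z) = p * ((u + (1 - z)) + u * (1 - z)).
  by apply/eqP; rewrite -subr_eq0 -H; apply/eqP; ring.
clear H.
have := ler_nrmB_nrmD (1 - z) u; rewrite (addrC _ u).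
have /andP[+ _] := nrm_sub1 z; rewrite nrmM -(nrmN (z - 1)) opprB ?tE.
have := nrm_ge0 p; have := nrm_ge0 u.
move: hu hp; set y := nrm (1 - z); set U := nrm u; set P := nrm p; set A := nrm _.
move=> hu hp u0 p0 hy hA E.
have h1 : (1 - t ^+ 2) * (y - U) <= t ^+ 2 * (U * y).
  have A0 : 0 <= A by apply: nrm_ge0.
  apply: le_trans (_ : (1 - t ^+ 2) * A <= _); first by apply: ler_wpM2l => //; nra.
  apply: le_trans (_ : (1 - P) * A <= _); first by apply: ler_wpM2r => //; nra.
  by apply: le_trans E _; apply: ler_wpM2r => //; apply: mulr_ge0 => //; lra.
have h2 : (1 - t ^+ 2) * (y - t ^+ 3) <= t ^+ 2 * (t ^+ 3 * y).
  apply: le_trans (_ : (1 - t ^+ 2) * (y - U) <= _); first by apply: ler_wpM2l; nra.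
  by apply: le_trans h1 _; apply: ler_wpM2l; rewrite ?exprn_ge0 //; apply: ler_wpM2r => //; lra.
(* So far y = |1 - z| is kept exact, as it occurs on both sides. Once its collected coefficient is
   known to be nonnegative, y >= 1 - t can be inserted. *)
have h3 : 0 <= 1 - t ^+ 2 - t ^+ 5 by nra.
have h4 : (1 - t) * (1 - t ^+ 2 - t ^+ 5) <= y * (1 - t ^+ 2 - t ^+ 5) by apply: ler_wpM2r.
have h5 : t ^+ 2 * (1 - t) < 1 - t - t ^+ 3 by nra.
have h6 : t ^+ 5 <= t ^+ 2 * (1 - t ^+ 2) by nra.
have h7 : t ^+ 2 * (1 - t) * (1 - t ^+ 2) < (1 - t - t ^+ 3) * (1 - t ^+ 2).
  by rewrite ltr_pM2r //; nra.
have h8 : t ^+ 5 * (1 - t) <= t ^+ 2 * (1 - t ^+ 2) * (1 - t) by apply: ler_wpM2r; lra.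
nra.
Qed.

(** Phi_r(z) = (z^r + 1) (z - 1) - z^r, so the remainder is just -u. *)
Lemma phiC_nz z t u p : nrm z = t -> t ^+ 2 + t < 1 -> nrm u <= t ^+ 2 -> nrm p <= t ^+ 2 ->
  (u * (z - 2) + z - 1) * p + (u + 1) * (z - 1) != 0.
Proof.
move=> tE ht; have /andP[t0 t1] := small_bounds tE ht.
move=> hu hp; apply/eqP => H.
have /nrm_perturb : (u + 1) * (z - 1) = - p * ((u + 1) * (z - 1) + - u).
  by apply/eqP; rewrite -subr_eq0 -H; apply/eqP; ring.
clear H.
have := ler_nrmB_nrmD 1 u; rewrite (addrC 1 u) nrm1.
have /andP[+ _] := nrm_sub1 z; rewrite nrmM !nrmN ?tE.
have := nrm_ge0 p; have := nrm_ge0 u => u0 p0 hy hA E.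
have h1 : (1 - t ^+ 2) * ((1 - t ^+ 2) * (1 - t)) <= t ^+ 2 * t ^+ 2.
  apply: le_trans (_ : nrm p * nrm u <= _); last exact: ler_pM.
  apply: le_trans E; apply: ler_pM; [nra | nra | nra |].
  by apply: ler_pM; nra.
have h2 : t * t <= (1 - t ^+ 2) * (1 - t ^+ 2) by apply: ler_pM => //; nra.
have h3 : t * t * (1 - t) <= t ^+ 2 * t ^+ 2 by nra.
nra.
Qed.

(** This serves r = 1, with p = z^n up to sign, and also n = 1 with the plus sign, where p = z^r:
    the two exponents exchange roles. *)
Lemma phi1C_nz z t p : nrm z = t -> t ^+ 2 + t < 1 -> nrm p <= t ^+ 2 ->
  (z ^+ 2 - z - 1) * p + (z ^+ 2 - 1) != 0.
Proof.
move=> tE ht; have /andP[t0 t1] := small_bounds tE ht.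
move=> hp; apply/eqP => H.
have /nrm_perturb : z ^+ 2 - 1 = - p * ((z ^+ 2 - 1) + - z).
  by apply/eqP; rewrite -subr_eq0 -H; apply/eqP; ring.
clear H.
have /andP[+ _] := nrm_sub1 (z ^+ 2); rewrite !nrmN nrmX ?tE => h E.
have := nrm_ge0 p => p0.
have h1 : (1 - t ^+ 2) * (1 - t ^+ 2) <= t ^+ 2 * t.
  apply: le_trans (_ : nrm p * t <= _); last exact: ler_wpM2r.
  by apply: le_trans E; apply: ler_pM; nra.
nra.
Qed.

(** For n = 1 and the plus sign, collecting [PhiA] by v = z^(r-1) gives the expression of
    [phi2AB_nz] with v for p. Here 1 + z is multiplied in at once. *)
Lemma phiA1_nz z t v : nrm z = t -> t ^+ 2 + t < 1 -> nrm v <= t ^+ 2 ->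
  z ^+ 2 - z + 1 + v * (z ^+ 3 - 2 * z ^+ 2 + z - 1) != 0.
Proof.
move=> tE ht; have /andP[t0 t1] := small_bounds tE ht.
move=> hv; apply/eqP => H.
have /(congr1 nrm) : - z ^+ 3 + v * (1 + (z ^+ 2 + (z ^+ 3 + - z ^+ 4))) = 1.
  by rewrite -[RHS]subr0 -(mulr0 (1 + z)) -H; ring.
clear H.
have := ler_nrmD (- z ^+ 3) (v * (1 + (z ^+ 2 + (z ^+ 3 + - z ^+ 4)))).
have := ler_nrmD 1 (z ^+ 2 + (z ^+ 3 + - z ^+ 4)); have := ler_nrmD (z ^+ 2) (z ^+ 3 + - z ^+ 4).
have := ler_nrmD (z ^+ 3) (- z ^+ 4); rewrite nrmM !nrmN !nrmX nrm1 ?tE.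
set a := nrm (1 + _) => h1 h2 h3 h4 E.
have h5 : nrm v * a <= t ^+ 2 * (1 + t ^+ 2 + t ^+ 3 + t ^+ 4).
  by apply: ler_pM; rewrite ?nrm_ge0 //; lra.
(* A rational number just above (sqrt 5 - 1) / 2 suffices for the last estimate. *)
have : t < 31/50 by nra.
nra.
Qed.

(** The added term is (z + 1) (z^2 - 1) and X(z) = (z^2 - 1)^2 - z^3. Collecting the common product
    gives a m (1 - t^2 b) <= t^5, too small for a >= 1 - t, m >= 1 - t^2 and t^2 b <= t. *)
Lemma xA_nz z t p : nrm z = t -> t ^+ 2 + t < 1 -> nrm p <= t ^+ 2 ->
  (z ^+ 4 - z ^+ 3 - 2 * z ^+ 2 + 1) * p + (z ^+ 3 + z ^+ 2 - z - 1) != 0.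
Proof.
move=> tE ht; have /andP[t0 t1] := small_bounds tE ht.
move=> hp; apply/eqP => H.
have E : (z + 1) * (z ^+ 2 - 1) = p * ((z ^+ 2 - 1) * ((z + 1) * - (z - 1)) + z ^+ 3).
  by apply/eqP; rewrite -subr_eq0 -H; apply/eqP; ring.
clear H.
have := congr1 nrm E; have := ler_nrmD ((z ^+ 2 - 1) * ((z + 1) * - (z - 1))) (z ^+ 3).
have := congr1 nrm (_ : (z + 1) * (z - 1) = z ^+ 2 - 1) => /(_ ltac:(ring)).
have /andP[+ _] := nrm_sub1 (z ^+ 2); have /andP[_ +] := nrm_sub1 z.
have := ler_nrmB_nrmD 1 z; rewrite (addrC 1 z).
have := nrm_ge0 (z - 1); have := nrm_ge0 p.
rewrite nrmM [nrm (p * _)]nrmM nrmM.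
rewrite [nrm ((z + 1) * - _)]nrmM [nrm ((z + 1) * _)]nrmM !nrmN !nrmX nrm1 tE.
clear E.
set a := nrm (z + 1); set b := nrm (z - 1); set m := nrm (z ^+ 2 - 1); set P := nrm p.
set B := nrm (_ + _) => P0 b0 ha hb hm Em hB E.
have h1 : a * m <= t ^+ 2 * (m * (a * b) + t ^+ 3).
  by rewrite E; apply: ler_pM => //; apply: nrm_ge0.
have h2 : t ^+ 2 <= a by lra.
have h3 : t <= m by lra.
have h4 : t ^+ 2 * b <= t ^+ 2 * (1 + t) by apply: ler_wpM2l; rewrite ?exprn_ge0.
have h5 : t ^+ 2 * (1 + t) <= t by nra.
have h6 : (1 - t) * (1 - t) * (1 - t ^+ 2) <= a * (1 - t ^+ 2 * b) * m.
  by apply: ler_pM; [nra | nra | apply: ler_pM; lra | lra].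
have h7 : t ^+ 2 * t ^+ 2 * t < (1 - t) * (1 - t) * (1 - t ^+ 2).
  by apply: ltr_pM; [nra | lra | apply: ltr_pM; nra | lra].
lra.
Qed.

Lemma xB_nz z t p : nrm z = t -> t ^+ 2 + t < 1 -> nrm p <= t ^+ 2 ->
  (z ^+ 4 - z ^+ 3 - 2 * z ^+ 2 + 1) * p + (z ^+ 4 - z ^+ 2 + 1) != 0.
Proof.
move=> tE ht; have /andP[t0 t1] := small_bounds tE ht.
move=> hp; apply/eqP => H; set Q := z ^+ 4 - z ^+ 2 + 1 in H *.
have /nrm_perturb : Q = - p * (Q + z ^+ 2 * - (1 + z)).
  by apply/eqP; rewrite -subr_eq0 -H /Q; apply/eqP; ring.
clear H.
(* Here 1 + z^2 takes the part of 1 + z in [phi2AB_nz], giving |Q| >= (1 - t^6) / (1 + t^2). *)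
have := congr1 nrm (_ : Q * (1 + z ^+ 2) = 1 + z ^+ 6); rewrite /Q => /(_ ltac:(ring)).
have := ler_nrmB_nrmD 1 (z ^+ 6); have := ler_nrmD 1 (z ^+ 2); have := ler_nrmD 1 z.
rewrite !nrmX !nrmM !nrmN ?nrmX nrm1 ?tE -/Q => h1 h2 h3 h4 h5.
have := nrm_ge0 Q; have := nrm_ge0 p; have := nrm_ge0 (1 + z) => y0 p0 q0.
have h6 : (1 - t ^+ 2) * nrm Q <= t ^+ 2 * (t ^+ 2 * (1 + t)).
  apply: le_trans (_ : nrm p * (t ^+ 2 * nrm (1 + z)) <= _).
    by apply: le_trans h5; apply: ler_wpM2r => //; lra.
  by apply: ler_pM; rewrite ?mulr_ge0 ?exprn_ge0 //; apply: ler_wpM2l; rewrite ?exprn_ge0.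
have h7 : 1 - t ^+ 6 <= nrm Q * (1 + t ^+ 2).
  by apply: le_trans (_ : _ <= nrm Q * nrm (1 + z ^+ 2)) _; [lra| apply: ler_wpM2l].
have h8 : (1 - t ^+ 2) * (1 - t ^+ 6) <= t * (t ^+ 2 * (1 + t ^+ 2)).
  apply: le_trans (_ : (1 - t ^+ 2) * (nrm Q * (1 + t ^+ 2)) <= _).
    by apply: ler_wpM2l => //; nra.
  rewrite [leLHS]mulrA; apply: le_trans (_ : t ^+ 2 * (t ^+ 2 * (1 + t)) * (1 + t ^+ 2) <= _).
    by apply: ler_wpM2r => //; nra.
  have h9 : t ^+ 2 * (1 + t) <= t by nra.
  have -> : t * (t ^+ 2 * (1 + t ^+ 2)) = t ^+ 2 * t * (1 + t ^+ 2) by ring.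
  by apply: ler_wpM2r; [nra | apply: ler_wpM2l; [nra | lra]].
have h9 : t * (t ^+ 2 * (1 + t ^+ 2)) < (1 - t ^+ 2) * (1 - t ^+ 6).
  have s2 : t ^+ 2 * 2 <= 1 by nra.
  have -> : t ^+ 6 = t ^+ 2 * t ^+ 2 * t ^+ 2 by ring.
  have s0 : 0 <= t ^+ 2 by apply: exprn_ge0.
  by apply: ltr_pM => //; [nra | lra | nra].
lra.
Qed.

Lemma xA1_nz z t : nrm z = t -> t ^+ 2 + t < 1 ->
  z ^+ 5 - z ^+ 4 - z ^+ 3 + z ^+ 2 - 1 != 0.
Proof.
move=> tE ht; have /andP[t0 t1] := small_bounds tE ht.
apply/eqP => H; have /(congr1 nrm) : (z ^+ 5 + - z ^+ 4) + (- z ^+ 3 + z ^+ 2) = 1.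
  by rewrite -[RHS]addr0 -H; ring.
clear H.
have := ler_nrmD (z ^+ 5 + - z ^+ 4) (- z ^+ 3 + z ^+ 2).
have := ler_nrmD (z ^+ 5) (- z ^+ 4); have := ler_nrmD (- z ^+ 3) (z ^+ 2).
rewrite !nrmN !nrmX nrm1 ?tE.
have : t < 31/50 by nra.
nra.
Qed.

(** The factorisation of [PhiB] for n = 1 and the plus sign, with u = z^r; its zeros lie on the unit
    circle. *)
Lemma phiB1_nz z t u : nrm z = t -> t ^+ 2 + t < 1 -> nrm u < 1 -> (z - 1) ^+ 2 * (u + 1) != 0.
Proof.
move=> tE ht; have /andP[t0 t1] := small_bounds tE ht => hu.
rewrite mulf_neq0 ?expf_neq0 //.
  by apply/eqP => /subr0_eq z1; move: t1; rewrite -tE z1 nrm1 ltxx.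
by apply/eqP => /eqP; rewrite addr_eq0 => /eqP u1; move: hu; rewrite u1 nrmN nrm1 ltxx.
Qed.

Lemma xB1_nz z t : nrm z = t -> t ^+ 2 + t < 1 -> (z ^+ 2 - 1) * (z ^+ 3 - z - 1) != 0.
Proof.
move=> tE ht; have /andP[t0 t1] := small_bounds tE ht.
rewrite mulf_neq0 ?(plastic_nz tE ht) //.
apply/eqP => /subr0_eq /(congr1 nrm); rewrite nrmX nrm1 tE; nra.
Qed.

(** * No root in (1, 2) for n = 1 and the minus sign *)

Section RealLine.
Variable R : realFieldType.
Implicit Types x u v : R.

(** [PhiA] is affine in v = x^(r-1) with negative slope, so v = 1 is the worst case and leaves x (x
    - 2) (x + 1) < 0. The other families with a parameter r likewise reduce to the least admissible
    power. *)
Lemma phiA_lt0 x v : 1 < x < 2 -> 1 <= v -> x ^+ 2 - x - 1 + v * (x ^+ 3 - 2 * x ^+ 2 - x + 1) < 0.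
Proof.
move=> /andP[x1 x2] hv.
have h : x ^+ 3 - 2 * x ^+ 2 - x + 1 < 0 by nra.
have h2 : v * (x ^+ 3 - 2 * x ^+ 2 - x + 1) <= x ^+ 3 - 2 * x ^+ 2 - x + 1 by nra.
nra.
Qed.

Lemma phiB_lt0 x u : 1 < x < 2 -> x ^+ 2 <= u -> u * (x ^+ 2 - 2 * x - 1) + x ^+ 2 - 1 < 0.
Proof.
move=> /andP[x1 x2] hu.
have h : x ^+ 2 - 2 * x - 1 < 0 by nra.
have h2 : u * (x ^+ 2 - 2 * x - 1) <= x ^+ 2 * (x ^+ 2 - 2 * x - 1) by nra.
have : 0 < x ^+ 3 * (2 - x) by apply: mulr_gt0; [apply: exprn_gt0 | ]; lra.
nra.
Qed.

Lemma phiC_lt0 x u : 1 < x < 2 -> 1 <= u -> u * (x ^+ 2 - 3 * x + 1) + (x - 1) ^+ 2 < 0.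
Proof.
move=> /andP[x1 x2] hu.
have h : x ^+ 2 - 3 * x + 1 < 0 by nra.
have h2 : u * (x ^+ 2 - 3 * x + 1) <= x ^+ 2 - 3 * x + 1 by nra.
nra.
Qed.

(** This is (x - 1) [PsiA] with w = x^(r+1); at w = x^2 it equals (x - 1) (x^3 - 2 x^2 - x + 1). *)
Lemma psiA_lt0 x w : 1 < x < 2 -> x ^+ 2 <= w -> w * (x ^+ 2 - 3 * x + 1) + 2 * x - 1 < 0.
Proof.
move=> /andP[x1 x2] hu.
have h : x ^+ 2 - 3 * x + 1 < 0 by nra.
have h2 : w * (x ^+ 2 - 3 * x + 1) <= x ^+ 2 * (x ^+ 2 - 3 * x + 1) by nra.
have h3 : x ^+ 3 - 2 * x ^+ 2 - x + 1 < 0 by nra.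
have : (x - 1) * (x ^+ 3 - 2 * x ^+ 2 - x + 1) < 0 by nra.
nra.
Qed.

Lemma psiB_lt0 x u : 1 < x < 2 -> x ^+ 2 <= u -> u * (x ^+ 3 - 2 * x ^+ 2 - 1) + x + 1 < 0.
Proof.
move=> /andP[x1 x2] hu.
have h : x ^+ 3 - 2 * x ^+ 2 - 1 < 0 by nra.
have h2 : u * (x ^+ 3 - 2 * x ^+ 2 - 1) <= x ^+ 2 * (x ^+ 3 - 2 * x ^+ 2 - 1) by nra.
(* At u = x^2 the expression is x - 1 times this quartic. *)
have h3 : x ^+ 3 * (x - 2) + x * (x - 2) * (x + 1) - 1 < 0.
  have : 0 < x ^+ 3 * (2 - x) by apply: mulr_gt0; [apply: exprn_gt0 | ]; lra.
  nra.
have : (x - 1) * (x ^+ 3 * (x - 2) + x * (x - 2) * (x + 1) - 1) < 0 by nra.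
nra.
Qed.

Lemma xA_lt0 x : 1 < x < 2 -> x ^+ 5 - x ^+ 4 - 3 * x ^+ 3 - x ^+ 2 + 2 * x + 1 < 0.
Proof.
move=> /andP[x1 x2].
have h3 : 2 - x <= x ^+ 3 * (2 - x) by rewrite ler_peMl ?exprn_ege1; lra.
have h4 : 2 - x <= x ^+ 4 * (2 - x) by rewrite ler_peMl ?exprn_ege1; lra.
nra.
Qed.

Lemma xB_lt0 x : 1 < x < 2 -> x ^+ 5 - 2 * x ^+ 4 - 2 * x ^+ 3 + x ^+ 2 + x - 1 < 0.
Proof.
move=> /andP[x1 x2].
have h4 : 0 < x ^+ 4 * (2 - x) by apply: mulr_gt0; [apply: exprn_gt0 | ]; lra.
nra.
Qed.
End RealLine.

(** * Powers, signs and geometric sums *)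

Lemma nrm_exp_le z t j k : nrm z = t -> t ^+ 2 + t < 1 -> (j <= k)%N -> nrm (z ^+ k) <= t ^+ j.
Proof.
move=> tE ht jk; have /andP[t0 t1] := small_bounds tE ht.
by rewrite nrmX tE; apply: ler_wiXn2l => //; apply: ltW.
Qed.

Lemma nrm_sgnM s z : nrm (sgn s * z) = nrm z.
Proof. by case: s; rewrite ?mul1r // mulN1r nrmN. Qed.

(** As [sgn s] squares to 1, the sign can be moved onto the power, whose modulus it leaves
    unchanged. *)
Lemma sgn_swap s a p b : a * p + sgn s * b = 0 -> a * (sgn s * p) + b = 0.
Proof.
move=> H; rewrite -(mulr0 (sgn s)) -H; case: s {H}; rewrite /sgn; ring.
Qed.

Lemma Psi_geom r x : (x - 1) * Psi r x = x ^+ r.+2 - 2 * x ^+ r.+1 + 1.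
Proof. by rewrite /Psi mulrBr -subrX1 (exprS x r.+1); ring. Qed.

Lemma sumX_tail_le z t r : nrm z = t -> t ^+ 2 + t < 1 ->
  nrm (\sum_(i < r.+1) z ^+ i - 1) * (1 - t) <= t - t ^+ r.+1.
Proof.
move=> tE ht; have /andP[t0 t1] := small_bounds tE ht.
elim: r => [|r IHr].
  by rewrite big_ord_recl big_ord0 addr0 subrr expr1 subrr nrm0 mul0r.
rewrite big_ord_recr /= -addrA (addrC _ (-1)) addrA.
have h := ler_nrmD (\sum_(i < r.+1) z ^+ i - 1) (z ^+ r.+1).
have := ler_wpM2r (_ : 0 <= 1 - t) h; rewrite nrmX tE => /(_ ltac:(lra)) h2.
apply: le_trans h2 _; rewrite mulrDl (exprS t r.+1); lra.
Qed.

(** * Each family against a conjugate of small modulus *)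

Section Conjugates.
Variables (x t : algR) (z : algC).
Hypotheses (hx : 1 < x < 2) (tE : nrm z = t) (ht : t ^+ 2 + t < 1).
Hypothesis conj : forall F, ratpolyfun F -> F (algRval x) = 0 -> F z = 0.

Let small k : (2 <= k)%N -> nrm (z ^+ k) <= t ^+ 2.
Proof. exact: nrm_exp_le. Qed.
Let sgn_small s k : (2 <= k)%N -> nrm (sgn s * z ^+ k) <= t ^+ 2.
Proof. by rewrite nrm_sgnM; apply: nrm_exp_le. Qed.
Let small3 k : (3 <= k)%N -> nrm (z ^+ k) <= t ^+ 3.
Proof. exact: nrm_exp_le. Qed.

Let x_exp_ge1 k : 1 <= x ^+ k.
Proof. by apply: exprn_ege1; case/andP: hx => /ltW. Qed.
Let x_exp_ge2 k : (2 <= k)%N -> x ^+ 2 <= x ^+ k.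
Proof. by move=> k2; apply: ler_weXn2l => //; case/andP: hx => /ltW. Qed.

Let lift_lt0 (y : algR) : y < 0 -> algRval y = 0 -> False.
Proof. by move=> y0 /eqP; rewrite fmorph_eq0 lt_eqF. Qed.

Ltac lift_ring := rewrite !(rmorphD, rmorphN, rmorphM, rmorphXn, rmorph1, rmorph_nat) /=.

Lemma Phi_conj r : (0 < r)%N -> Phi r x <> 0.
Proof.
move=> r0 /(conj (ratpolyfun_Phi r)); case: r r0 => // -[|[|r]] _; apply/eqP.
- apply: contra_neq (golden_nz tE ht) => <-; rewrite /Phi; ring.
- apply: contra_neq (phi2_nz tE ht) => <-; rewrite /Phi; ring.
- apply: contra_neq (phi_nz tE ht (small3 (k := r.+3) _)) => // <-.
  rewrite /Phi (exprS _ r.+3); ring.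
Qed.

Lemma Psi_conj r : (0 < r)%N -> Psi r x <> 0.
Proof.
move=> r0 /(conj (ratpolyfun_Psi r)) H.
have /eqP := psi_nz tE ht (small (k := r.+1) r0); apply.
rewrite -[RHS](mulr0 (z - 1)) -H Psi_geom (exprS z r.+1); ring.
Qed.

Lemma Xpol_conj : Xpol x <> 0.
Proof.
by move=> /(conj ratpolyfun_Xpol); apply/eqP; apply: contra_neq (xpol_nz tE ht) => <-.
Qed.

(** The common form for r = 1: [PhiA] divided by x (m = n - 1), and [PhiB] and [PsiB] (m = n). For m
    <= 1 it either splits into factors without a root in (1, 2) or is the tribonacci polynomial. *)
Lemma golden_conj s m : ((x : algC) ^+ 2 - algRval x - 1) * algRval x ^+ m + sgn s <> 0.
Proof.
move=> H.
have Hz : (z ^+ 2 - z - 1) * z ^+ m + sgn s * 1 = 0.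
  by apply: (conj (F := fun y => (y ^+ 2 - y - 1) * y ^+ m + sgn s * 1)); [ratpoly | rewrite mulr1].
case: m H Hz => [|[|m]] H Hz.
- case/andP: hx => x1 x2; case: s H {Hz} => H.
    apply: (@lift_lt0 (- (x * (x - 1)))); first by clear H; rewrite oppr_lt0 mulr_gt0; lra.
    lift_ring; rewrite -[RHS](oppr0) -H /sgn; ring.
  apply: (@lift_lt0 ((x - 2) * (x + 1))); first by clear H; nra.
  lift_ring; rewrite -H /sgn; ring.
- case: s H Hz => H Hz; last first.
    have /eqP := tribonacci_nz tE ht; apply; rewrite -Hz /sgn; ring.
  case/andP: hx => x1 x2.
  apply: (@lift_lt0 (- ((x - 1) ^+ 2 * (x + 1)))).
    by clear H Hz; rewrite oppr_lt0 mulr_gt0 ?exprn_gt0; lra.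
  lift_ring; rewrite -[RHS](oppr0) -H /sgn; ring.
- have /eqP := golden_perturb_nz tE ht (sgn_small s (k := m.+2) isT); apply.
  exact: sgn_swap Hz.
Qed.

Let x_neq0 : algRval x != 0.
Proof. by rewrite fmorph_eq0 gt_eqF //; case/andP: hx; lra. Qed.
Let x_neq1 : algRval x - 1 != 0.
Proof. by rewrite -(rmorph1 algRval) -rmorphB fmorph_eq0 gt_eqF //; case/andP: hx; lra. Qed.

Lemma PhiA_conj s r n : (0 < r)%N -> (0 < n)%N -> PhiA s r n x <> 0.
Proof.
case: r n => [//|r] [//|n] _ _ H; have Hz := conj (ratpolyfun_PhiA _ _ _) H.
case: r H Hz => [|r] H Hz.
  apply: (@golden_conj s n); apply: (mulfI x_neq0); rewrite mulr0 -H /PhiA /Phi /=.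
  rewrite (exprS _ n); ring.
case: n H Hz => [|n] H Hz.
  case: s H Hz => H Hz; last first.
    apply: (lift_lt0 (phiA_lt0 hx (x_exp_ge1 r.+1))).
    lift_ring; rewrite -H /PhiA /Phi /sgn /= (exprS _ r.+2) (exprS _ r.+1); ring.
  (* For r = 2 the power v = z has modulus t, too large for [phiA1_nz]; the polynomial is then (x^2
     + 1) (x - 1)^2. *)
  case: r H Hz => [|r] H Hz.
    case/andP: hx => x1 x2; apply: (@lift_lt0 (- ((x ^+ 2 + 1) * (x - 1) ^+ 2))).
      by clear H Hz; rewrite oppr_lt0 mulr_gt0 ?exprn_gt0; nra.
    lift_ring; rewrite -[RHS](oppr0) -H /PhiA /Phi /sgn /=; ring.
  have /eqP := phiA1_nz tE ht (small (k := r.+2) isT); apply.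
  rewrite -Hz /PhiA /Phi /sgn /= (exprS _ r.+3) (exprS _ r.+2); ring.
move/sgn_swap: Hz; case: r H => [|r] _ /=; apply/eqP.
  apply: contra_neq (phi2AB_nz tE ht (sgn_small s (k := n.+2) isT)) => <-.
  rewrite /Phi; ring.
apply: contra_neq (phiA_nz tE ht (small (k := r.+2) isT) (sgn_small s (k := n.+2) isT)) => <-.
rewrite /Phi (exprS _ r.+3) (exprS _ r.+2); ring.
Qed.

Lemma PhiB_conj s r n : (0 < r)%N -> (0 < n)%N -> PhiB s r n x <> 0.
Proof.
case: r n => [//|r] [//|n] _ _ H; have Hz := conj (ratpolyfun_PhiB _ _ _) H.
case: r H Hz => [|r] H Hz.
  apply: (@golden_conj s n.+1); rewrite -H /PhiB /Phi; ring.
case: n H Hz => [|n] H Hz.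
  case: s H Hz => H Hz; last first.
    apply: (lift_lt0 (phiB_lt0 hx (x_exp_ge2 (k := r.+2) isT))).
    lift_ring; rewrite -H /PhiB /Phi /sgn (exprS _ r.+2); ring.
  have r1 : nrm (z ^+ r.+2) < 1.
    apply: le_lt_trans (small (k := r.+2) isT) _.
    by have /andP[t0 _] := small_bounds tE ht; move: ht; clear H Hz; lra.
  have /eqP := phiB1_nz tE ht r1; apply.
  rewrite -Hz /PhiB /Phi /sgn (exprS _ r.+2); ring.
move/sgn_swap: Hz; case: r H => [|r] _; apply/eqP.
  apply: contra_neq (phi2AB_nz tE ht (sgn_small s (k := n.+2) isT)) => <-.
  rewrite /Phi; ring.
apply: contra_neq (phiB_nz tE ht (small3 (k := r.+3) isT) (sgn_small s (k := n.+2) isT)) => <-.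
rewrite /Phi (exprS _ r.+3); ring.
Qed.

Lemma PhiC_conj s r n : (0 < r)%N -> (0 < n)%N -> PhiC s r n x <> 0.
Proof.
case: r n => [//|r] [//|n] _ _ H; have Hz := conj (ratpolyfun_PhiC _ _ _) H.
case: n H Hz => [|n] H Hz.
  case: s H Hz => H Hz; last first.
    apply: (lift_lt0 (phiC_lt0 hx (x_exp_ge1 r.+1))).
    lift_ring; rewrite -H /PhiC /Phi /sgn (exprS _ r.+1); ring.
  case: r H Hz => [|r] H Hz.
    have /eqP := plastic_nz tE ht; apply; rewrite -Hz /PhiC /Phi /sgn; ring.
  have /eqP := phi1C_nz tE ht (small (k := r.+2) isT); apply.
  rewrite -Hz /PhiC /Phi /sgn (exprS _ r.+2); ring.
move/sgn_swap: Hz; case: r H => [|r] _; apply/eqP.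
  apply: contra_neq (phi1C_nz tE ht (sgn_small s (k := n.+2) isT)) => <-.
  rewrite /Phi; ring.
apply: contra_neq (phiC_nz tE ht (small (k := r.+2) isT) (sgn_small s (k := n.+2) isT)) => <-.
rewrite /Phi (exprS _ r.+2); ring.
Qed.

Lemma PsiA_conj s r n : (0 < r)%N -> (0 < n)%N -> PsiA s r n x <> 0.
Proof.
case: r n => [//|r] [//|n] _ _ H; have Hz := conj (ratpolyfun_PsiA _ _ _) H.
have geom (y : algC) : (y - 1) * PsiA s r.+1 n.+1 y =
    (y ^+ r.+3 - 2 * y ^+ r.+2 + 1) * y ^+ n.+1 + sgn s * (y - 1) * (y ^+ r.+2 - 1).
  by rewrite /PsiA -Psi_geom; ring.
case: n H Hz geom => [|n] H Hz geom.
  case: s H Hz geom => H Hz geom; last first.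
    apply: (lift_lt0 (psiA_lt0 hx (x_exp_ge2 (k := r.+2) isT))).
    lift_ring; rewrite -[RHS](mulr0 (algRval x - 1)) -H geom /sgn (exprS _ r.+2); ring.
  (* For n = 1 and the plus sign, (z - 1) [PsiA] collapses to (z^2 - z - 1) z^(r+1) + 1, in terms of
     the original r. *)
  have /eqP := golden_perturb_nz tE ht (small (k := r.+2) isT); apply.
  rewrite -[RHS](mulr0 (z - 1)) -Hz geom /sgn (exprS _ r.+2); ring.
move/sgn_swap: Hz; apply/eqP.
have /andP[t0 t1] := small_bounds tE ht.
apply: (psiA_nz tE ht _ _ (sgn_small s (k := n.+2) isT)).
  by rewrite nrmX tE; apply: sumX_tail_le.
by apply: le_lt_trans (small (k := r.+2) isT) _; move: ht; clear H geom; lra.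
Qed.

Lemma PsiB_conj s r n : (0 < r)%N -> (0 < n)%N -> PsiB s r n x <> 0.
Proof.
case: r n => [//|r] [//|n] _ _ H; have Hz := conj (ratpolyfun_PsiB _ _ _) H.
case: r H Hz => [|r] H Hz.
  apply: (@golden_conj s n.+1); rewrite -H /PsiB /Psi !big_ord_recl !big_ord0 /=; ring.
have geom (y : algC) : (y - 1) * PsiB s r.+2 n.+1 y =
    (y ^+ r.+4 - 2 * y ^+ r.+3 + 1) * y ^+ n.+1 + sgn s * (y ^+ r.+2 - 1).
  by rewrite /PsiB -Psi_geom subrX1; ring.
case: n H Hz geom => [|n] H Hz geom.
  case: s H Hz geom => H Hz geom; last first.
    apply: (lift_lt0 (psiB_lt0 hx (x_exp_ge2 (k := r.+2) isT))).
    lift_ring; rewrite -[RHS](mulr0 (algRval x - 1)) -H geom /sgn.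
    rewrite (exprS _ r.+3) (exprS _ r.+2); ring.
  (* The product with x - 1 still contains a factor x - 1. It is cancelled at x > 1, and the reduced
     equation is what passes to z. *)
  have Gx : (algRval x ^+ 2 - algRval x - 1) * algRval x ^+ r.+2 + 1 = 0.
    apply: (mulfI x_neq1); rewrite mulr0 -[RHS](mulr0 (algRval x - 1)) -H geom /sgn.
    rewrite (exprS _ r.+3) (exprS _ r.+2); ring.
  have /eqP := golden_perturb_nz tE ht (small (k := r.+2) isT); apply.
  by apply: (conj (F := fun y => (y ^+ 2 - y - 1) * y ^+ r.+2 + 1) _ Gx); ratpoly.
have : (z ^+ r.+4 - 2 * z ^+ r.+3 + 1) * z ^+ n.+2 + sgn s * (z ^+ r.+2 - 1) = 0.
  by rewrite -geom Hz mulr0.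
move/sgn_swap; apply/eqP.
apply: contra_neq (psiB_nz tE ht (small (k := r.+2) isT) (sgn_small s (k := n.+2) isT)) => <-.
rewrite (exprS _ r.+3) (exprS _ r.+2); ring.
Qed.

Lemma XA_conj s n : (0 < n)%N -> XA s n x <> 0.
Proof.
case: n => [//|n] _ H; have Hz := conj (ratpolyfun_XA _ _) H.
case: n H Hz => [|n] H Hz.
  case: s H Hz => H Hz; last first.
    by apply: (lift_lt0 (xA_lt0 hx)); lift_ring; rewrite -H /XA /Xpol /sgn; ring.
  by have /eqP := xA1_nz tE ht; apply; rewrite -Hz /XA /Xpol /sgn; ring.
move/sgn_swap: Hz; apply/eqP.
exact: (xA_nz tE ht (sgn_small s (k := n.+2) isT)).
Qed.

Lemma XB_conj s n : (0 < n)%N -> XB s n x <> 0.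
Proof.
case: n => [//|n] _ H; have Hz := conj (ratpolyfun_XB _ _) H.
case: n H Hz => [|n] H Hz.
  case: s H Hz => H Hz; last first.
    by apply: (lift_lt0 (xB_lt0 hx)); lift_ring; rewrite -H /XB /Xpol /sgn; ring.
  by have /eqP := xB1_nz tE ht; apply; rewrite -Hz /XB /Xpol /sgn; ring.
move/sgn_swap: Hz; apply/eqP.
exact: (xB_nz tE ht (sgn_small s (k := n.+2) isT)).
Qed.
End Conjugates.

(** * The golden bound and the conclusion *)

(** Squaring 2 t + 1 < sqrt 5 gives 4 t^2 + 4 t < 4. *)
Lemma golden_ratio_bound (t : algR) : 0 <= t -> algRval t < (sqrtC 5 - 1) / 2 -> t ^+ 2 + t < 1.
Proof.
move=> t0 h.
have h1 : 2 * algRval t + 1 < sqrtC 5.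
  by move: h; rewrite ltr_pdivlMr ?ltr0n // ltrBrDr mulrC.
have h2 : (2 * algRval t + 1) ^+ 2 < 5.
  by rewrite -[ltRHS]sqrtCK ltrXn2r // ?sqrtC_ge0 ?ler0n // addr_ge0 ?mulr_ge0 ?ler0n.
have h3 : (2 * t + 1) ^+ 2 < 5 :> algR.
  suff : algRval ((2 * t + 1) ^+ 2) < algRval 5 by [].
  by rewrite !(rmorphD, rmorphM, rmorphXn, rmorph1, rmorph_nat).
nra.
Qed.

Theorem theorem3p4 (q q' : algC) :
  regular_pisot q -> galois_conj q q' -> (sqrtC 5 - 1) / 2 <= `|q'|.
Proof.
move=> [[q_real _ _ _] [hq Dq]] qq'.
(* The order on [algC] is partial, so negating the inequality requires both sides to be real. *)
rewrite real_leNgt ?normr_real ?rpredM ?rpredB ?rpredV ?rpred1 ?realn //;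
  rewrite ?ger0_real ?sqrtC_ge0 ?ler0n //.
apply/negP => /(golden_ratio_bound (nrm_ge0 q')) ht.
pose x : algR := in_algR q_real.
have hx : 1 < x < 2 by rewrite -(rmorph_nat algRval 2) in hq.
have conj F : ratpolyfun F -> F (algRval x) = 0 -> F q' = 0.
  by move=> Frat; apply: galois_conj_root.
have tE := erefl (nrm q').
case: Dq => [[r [r0 [|]]]|[|[]]].
- exact: (Phi_conj tE ht conj).
- exact: (Psi_conj tE ht conj).
- exact: (Xpol_conj tE ht conj).
- case=> s [r [n [r0 [n0 [[|]| | |]]]]].
  + exact: (PhiA_conj hx tE ht conj).
  + exact: (PhiB_conj hx tE ht conj).
  + exact: (PhiC_conj hx tE ht conj).
  + exact: (PsiA_conj hx tE ht conj).
  + exact: (PsiB_conj hx tE ht conj).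
- case=> s [n [n0 []]].
  + exact: (XA_conj hx tE ht conj).
  + exact: (XB_conj hx tE ht conj).
Qed.
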